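(* Let $\mathscr{Q}$ be a commutative semicartesian quantale and let $\mathrm{E}\mathscr{Q}=\{e\in\mathscr{Q}: e\otimes e=e\}$ be its set of idempotent elements. Then the $\mathscr{Q}$-set $\top=(\mathrm{E}\mathscr{Q},\delta)$ with $\delta(e,e')=e\otimes e'$ is a terminal object of the category $\mathscr{Q}\text{-}\mathbf{Set}$ of $\mathscr{Q}$-sets and functional morphisms.
   Context: A quantale $\mathscr{Q}=(|\mathscr{Q}|,\leq,\otimes)$ is a complete lattice with an associative binary operation $\otimes$ that distributes over arbitrary suprema (including the empty one) in each variable. It is commutative if $\otimes$ is commutative, and semicartesian if $a\otimes b\leq a\wedge b$ for all $a,b$. A $\mathscr{Q}$-set is a set $X$ with a map $\delta:X\times X\to\mathscr{Q}$ such that for all $x,y,z\in X$: (1) $\delta(x,y)=\delta(y,x)$; (2) $\delta(x,y)\otimes\delta(y,z)\leq\delta(x,z)$; (3) $\delta(x,x)\otimes\delta(x,y)=\delta(x,y)$. The extent of $x$ is $\mathrm{E}x=\delta(x,x)$. A functional morphism $f:X\to Y$ of $\mathscr{Q}$-sets is a function between the underlying sets with $\delta_X(x,x')\leq\delta_Y(f(x),f(x'))$ and $\mathrm{E}f(x)=\mathrm{E}x$ for all $x,x'\in X$. $\mathscr{Q}\text{-}\mathbf{Set}$ is the category of $\mathscr{Q}$-sets and functional morphisms. *)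

(* Defs.v *)
From HB Require Import structures.
From mathcomp Require Import all_boot all_order.
From mathcomp Require Import boolp classical_sets.

Set Implicit Arguments.
Unset Strict Implicit.
Unset Printing Implicit Defensive.

Import Order.TTheory.
Local Open Scope classical_set_scope.
Local Open Scope order_scope.

HB.mixin Record isCompleteLattice (d : Order.disp_t) Q
    of Order.TBLattice d Q := {
  supremums_neq0 : forall A : set Q, supremums A !=set0;
  infimums_neq0 : forall A : set Q, infimums A !=set0
}.

#[short(type="completeLatticeType")]
HB.structure Definition CompleteLattice (d : Order.disp_t) :=
  { Q of isCompleteLattice d Q & Order.TBLattice d Q }.

(* Distributivity is phrased with the relation [supremums A s], meaning that
   [s] is the least upper bound of [A]; [A] may be empty, so that
   [a ⊗ \bot = \bot = \bot ⊗ a]. No unit is required. *)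
HB.mixin Record isQuantale (d : Order.disp_t) Q of CompleteLattice d Q := {
  qmul : Q -> Q -> Q;
  qmulA : associative qmul;
  qmul_supr : forall (a : Q) (A : set Q) (s : Q),
    supremums A s -> supremums [set qmul a x | x in A] (qmul a s);
  qmul_supl : forall (a : Q) (A : set Q) (s : Q),
    supremums A s -> supremums [set qmul x a | x in A] (qmul s a)
}.

#[short(type="quantaleType")]
HB.structure Definition Quantale (d : Order.disp_t) :=
  { Q of isQuantale d Q & CompleteLattice d Q }.

Notation "a ⊗ b" := (qmul a b) (at level 40, left associativity).

Section QuantaleProperties.
Variables (d : Order.disp_t) (Q : quantaleType d).

Definition commutative_quantale : Prop := forall a b : Q, a ⊗ b = b ⊗ a.

Definition semicartesian_quantale : Prop :=
  forall a b : Q, a ⊗ b <= a `&` b.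

Definition idempotents : Type := {e : Q | e ⊗ e == e}.

End QuantaleProperties.

Record category := Category {
  obj : Type;
  hom : obj -> obj -> Type;
  idmap : forall a, hom a a;
  comp : forall a b c, hom b c -> hom a b -> hom a c;
  comp1m : forall a b (f : hom a b), comp (idmap b) f = f;
  compm1 : forall a b (f : hom a b), comp f (idmap a) = f;
  compA : forall a b c e (h : hom c e) (g : hom b c) (f : hom a b),
    comp h (comp g f) = comp (comp h g) f
}.

Definition terminal_object (C : category) (t : obj C) : Prop :=
  forall a : obj C, exists! f : hom a t, True.
Arguments terminal_object : clear implicits.

Section QSets.
Variables (d : Order.disp_t) (Q : quantaleType d).

Record is_qset (X : Type) (delta : X -> X -> Q) : Prop := IsQSet {
  qset_sym : forall x y, delta x y = delta y x;
  qset_trans : forall x y z, delta x y ⊗ delta y z <= delta x z;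
  qset_extent : forall x y, delta x x ⊗ delta x y = delta x y
}.

Record qset := QSet {
  qset_carrier :> Type;
  qdelta : qset_carrier -> qset_carrier -> Q;
  qset_axioms : is_qset qdelta
}.

Definition extent (X : qset) (x : X) : Q := qdelta x x.

Definition is_functional_morphism (X Y : qset) (f : X -> Y) : Prop :=
  (forall x x' : X, qdelta x x' <= qdelta (f x) (f x')) /\
  (forall x : X, extent (f x) = extent x).

Definition functional_morphism (X Y : qset) : Type :=
  {f : X -> Y | is_functional_morphism f}.

Lemma functional_morphism_id (X : qset) :
  is_functional_morphism (fun x : X => x).
Proof. by split. Qed.

Lemma functional_morphism_comp (X Y Z : qset) (g : functional_morphism Y Z)
    (f : functional_morphism X Y) :
  is_functional_morphism (fun x => sval g (sval f x)).
Proof.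
case: g f => [g [gd gE]] [f [fd fE]]; split=> [x x'|x] /=.
  exact: le_trans (fd x x') (gd _ _).
by rewrite gE fE.
Qed.

Definition qset_id (X : qset) : functional_morphism X X :=
  exist _ _ (functional_morphism_id X).

Definition qset_comp (X Y Z : qset) (g : functional_morphism Y Z)
    (f : functional_morphism X Y) : functional_morphism X Z :=
  exist _ _ (functional_morphism_comp g f).

Lemma functional_morphism_eq (X Y : qset) (f g : functional_morphism X Y) :
  sval f = sval g -> f = g.
Proof. by case: f g => [f fP] [g gP] /=; exact: eq_exist. Qed.

Lemma qset_comp1m (X Y : qset) (f : functional_morphism X Y) :
  qset_comp (qset_id Y) f = f.
Proof. exact: functional_morphism_eq. Qed.

Lemma qset_compm1 (X Y : qset) (f : functional_morphism X Y) :
  qset_comp f (qset_id X) = f.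
Proof. exact: functional_morphism_eq. Qed.

Lemma qset_compA (X Y Z T : qset) (h : functional_morphism Z T)
    (g : functional_morphism Y Z) (f : functional_morphism X Y) :
  qset_comp h (qset_comp g f) = qset_comp (qset_comp h g) f.
Proof. exact: functional_morphism_eq. Qed.

Definition qset_category : category :=
  Category qset_comp1m qset_compm1 qset_compA.

Definition top_delta (e e' : idempotents Q) : Q := sval e ⊗ sval e'.

End QSets.
Arguments qset_category {d} Q.
Arguments top_delta {d} Q.

(* Main.v *)
Require Import Defs.
From mathcomp Require Import all_boot all_order.
From mathcomp Require Import boolp.

(** The extent of an idempotent [e] in the candidate terminal object is
    [e ⊗ e = e]. A functional morphism preserves extents, so the only possible
    one into it sends [x] to its extent, which is idempotent by the extent axiom
    ([extent_idem]). This map does not decrease [qdelta]: the extents of both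
    arguments can be absorbed into [qdelta x x'], and in a semicartesian
    quantale dropping a factor can only increase a product, whence
    [qdelta x x' <= extent x ⊗ extent x'] ([qdelta_le_extents]). *)

Set Implicit Arguments.
Unset Strict Implicit.
Unset Printing Implicit Defensive.

Import Order.TTheory.
Local Open Scope order_scope.

Lemma qmul_lel (d : Order.disp_t) (Q : quantaleType d) :
  semicartesian_quantale Q -> forall a b : Q, a ⊗ b <= a.
Proof. by move=> Qsemi a b; apply: le_trans (Qsemi a b) (leIl a b). Qed.

Lemma top_is_qset (d : Order.disp_t) (Q : quantaleType d) :
  commutative_quantale Q -> semicartesian_quantale Q ->
  is_qset (top_delta Q).
Proof.
move=> Qcomm Qsemi; rewrite /top_delta.
split=> [x y|[x xx] [y /eqP yy] [z zz]|[x /eqP xx] y] /=.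
- exact: Qcomm.
- (* By idempotence of [y] the left-hand side is [(x ⊗ z) ⊗ y]. *)
  by rewrite qmulA -(qmulA x y y) yy -qmulA (Qcomm y z) qmulA qmul_lel.
- by rewrite xx qmulA xx.
Qed.

Lemma extent_idem (d : Order.disp_t) (Q : quantaleType d) (X : qset Q) (x : X) :
  extent x ⊗ extent x == extent x.
Proof. by apply/eqP; apply: (qset_extent (qset_axioms X)). Qed.

Lemma qdelta_le_extents (d : Order.disp_t) (Q : quantaleType d) (X : qset Q) :
  semicartesian_quantale Q ->
  forall x x' : X, qdelta x x' <= extent x ⊗ extent x'.
Proof.
move=> Qsemi x x'; have [sym _ ext] := qset_axioms X.
by rewrite -ext sym -(ext x') qmulA qmul_lel.
Qed.

Theorem mainTheorem2 (d : Order.disp_t) (Q : quantaleType d)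
    (Qcomm : commutative_quantale Q) (Qsemi : semicartesian_quantale Q) :
  exists top_qset : is_qset (top_delta Q),
    terminal_object (qset_category Q) (QSet top_qset).
Proof.
exists (top_is_qset Qcomm Qsemi) => X.
pose f (x : (X : qset Q)) : QSet (top_is_qset Qcomm Qsemi) :=
  exist _ (extent x) (extent_idem x).
have fP : is_functional_morphism f.
  split=> [x x'|x]; first exact: qdelta_le_extents.
  exact/eqP/extent_idem.
exists (exist _ f fP); split=> // -[g [gd gE]] _.
apply: functional_morphism_eq; apply/funext => x /=.
(* The value [g x] is idempotent, hence equal to its own extent. *)
by apply: val_inj; rewrite /= -(gE x); exact/eqP/(svalP (g x)).
Qed.
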